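(* Let $X$ be a join space. Then $X$ is preprojective if and only if $X$ is join-transitive and the pair consisting of $X$ and the set of join-closed subsets of $X$ is a matroid.
   Context: A join space is a set $X$ with a ternary relation $\langle\cdot,\cdot,\cdot\rangle$ on $X$ such that: $\langle a,x,x\rangle$ for all $a,x\in X$; $\langle x,b,y\rangle$ implies $\langle y,b,x\rangle$ for all $x,b,y\in X$; and $\langle x,y,x\rangle$ implies $y=x$ for all $x,y\in X$. For $a,c\in X$ put $ac:=\{x\in X\mid\langle a,x,c\rangle\}$. For $A\subseteq X$ and $x,y\in X$, $\langle A,x,y\rangle$ means that there is $a\in A$ with $\langle a,x,y\rangle$. $X$ is transitive iff for all $a,b,c\in X$, $\langle a,b,c\rangle$ implies $ab\subseteq ac$. $X$ is symmetric iff for all $a,b,c\in X$, $\langle a,b,c\rangle$ and $a\neq b$ imply $\langle a,c,b\rangle$. $X$ is equivalence-relational iff it is transitive and symmetric. $X$ is join-transitive iff for all $a,b\in X$, with $A:=ab$, the binary relation $\langle A,\cdot,\cdot\rangle$ is transitive on $X$. $X$ is preprojective iff it is equivalence-relational and for all $a,b,c,d\in X$: if $b=c$ or $a=d$ or $bc\cap ad\neq\emptyset$, then $a=b$ or $c=d$ or $ab\cap cd\neq\emptyset$. A subset $C\subseteq X$ is join-closed iff $ab\subseteq C$ for all $a,b\in C$. A closure space is a pair $(X,C)$ where $X$ is a set and $C$ is a set of subsets of $X$ (called closed sets) with $X\in C$ and $\bigcap D\in C$ for every non-empty $D\subseteq C$. For $A\subseteq X$, $\mathrm{cl}(A)$ is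 the smallest closed superset of $A$, and $\vdash_A$ is the binary relation on $X$ given by $x\vdash_A y:\Leftrightarrow y\in\mathrm{cl}(A\cup\{x\})$. $(X,C)$ is an exchange space iff for each closed $A\subseteq X$ the relation $\vdash_A$ is symmetric on $X\setminus A$. $(X,C)$ is combinatorial iff $\bigcup D\in C$ for each non-empty chain $D\subseteq C$ (with respect to inclusion). A matroid is a combinatorial exchange space (not necessarily finite). *)

(* Defs.v *)
From mathcomp Require Import all_boot.
From mathcomp Require Import classical_sets.

Set Implicit Arguments.
Unset Strict Implicit.
Unset Printing Implicit Defensive.

Local Open Scope classical_set_scope.

Section JoinSpace.
Variables (X : Type) (J : X -> X -> X -> Prop).
Implicit Types (a b c d x y z : X) (A : set X).

Definition join_space : Prop :=
  [/\ forall a x, J a x x,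
      forall x b y, J x b y -> J y b x
    & forall x y, J x y x -> y = x].

Definition join a c : set X := [set x | J a x c].

Definition join_rel A x y : Prop := exists2 a, A a & J a x y.

Definition join_space_transitive : Prop :=
  forall a b c, J a b c -> join a b `<=` join a c.

Definition join_space_symmetric : Prop :=
  forall a b c, J a b c -> a <> b -> J a c b.

Definition equivalence_relational : Prop :=
  join_space_transitive /\ join_space_symmetric.

Definition join_transitive : Prop :=
  forall a b x y z,
    join_rel (join a b) x y -> join_rel (join a b) y z ->
    join_rel (join a b) x z.

Definition preprojective : Prop :=
  equivalence_relational /\
  forall a b c d,
    [\/ b = c, a = d | join b c `&` join a d !=set0] ->
    [\/ a = b, c = d | join a b `&` join c d !=set0].

Definition join_closed : set (set X) :=
  [set C | forall a b, C a -> C b -> join a b `<=` C].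

End JoinSpace.

Section ClosureSpace.
Variables (X : Type) (C : set (set X)).
Implicit Types (A : set X) (D : set (set X)) (x y : X).

Definition closure_space : Prop :=
  C [set: X] /\
  forall D, D `<=` C -> D !=set0 -> C (\bigcap_(A in D) A).

Definition cl A : set X := smallest C A.

Definition entails A x y : Prop := cl (A `|` [set x]) y.

Definition exchange_space : Prop :=
  closure_space /\
  forall A, C A ->
    forall x y, ~ A x -> ~ A y -> entails A x y -> entails A y x.

Definition combinatorial : Prop :=
  forall D, D `<=` C -> D !=set0 -> total_on D subset ->
    C (\bigcup_(A in D) A).

Definition matroid : Prop := exchange_space /\ combinatorial.

End ClosureSpace.

(* Main.v *)
(** An equivalence-relational join space is a linear space: any two distinct
    points of a join [ab] span it.  In it, the preprojective axiom is the
    Veblen-Young axiom, and join-transitivity of [ab] is the same axiom seen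
    from two points of the line [ab].  Join-transitivity makes the union of the
    joins [cx], [c] in a non-empty join-closed set [C], join-closed, so that
    exchange over [C] reduces to symmetry.  Conversely, the joins [aa] and [ab]
    give transitivity and join-closedness of [ab], and exchange over the closed
    set [{a}] gives symmetry. *)
Require Import Defs.
From mathcomp Require Import all_boot.
From mathcomp Require Import boolp classical_sets.

Set Implicit Arguments.
Unset Strict Implicit.
Unset Printing Implicit Defensive.

Local Open Scope classical_set_scope.

Section JoinSpaceTheory.
Variables (X : Type) (J : X -> X -> X -> Prop).
Hypothesis joinJ : join_space J.
Implicit Types (a b c d x y z w : X) (C : set X).

Lemma J_right a x : J a x x.
Proof. by case: joinJ. Qed.

Lemma J_sym x b y : J x b y -> J y b x.
Proof. by case: joinJ => _ + _; apply. Qed.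

Lemma J_left a x : J a a x.
Proof. exact/J_sym/J_right. Qed.

Lemma J_diag x y : J x y x -> y = x.
Proof. by case: joinJ => _ _; apply. Qed.

Lemma join_closed1 a : join_closed J [set a].
Proof. by move=> x y /= -> -> z /J_diag. Qed.

Lemma join_closed_closure_space : closure_space (join_closed J).
Proof.
split=> [//|D DC _ a b Da Db x Jx A DA].
exact: (DC _ DA a b (Da _ DA) (Db _ DA)).
Qed.

Lemma join_closed_combinatorial : combinatorial (join_closed J).
Proof.
move=> D DC _ chain a b [A DA Aa] [B DB Bb] x Jx.
have [AB|BA] := chain _ _ DA DB.
  by exists B => //; apply: (DC _ DB a b) => //; exact: AB.
by exists A => //; apply: (DC _ DA a b) => //; exact: BA.
Qed.

Section EquivalenceRelational.
Hypothesis Jtrans : join_space_transitive J.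
Hypothesis Jsymm : join_space_symmetric J.

Lemma join_line a b c : J a b c -> a <> b -> join J a b = join J a c.
Proof.
move=> Jabc ab; apply/seteqP; split; first exact: Jtrans.
exact/Jtrans/Jsymm.
Qed.

(** If [x <> a], then [ab = ax], so [y] lies on [xa] and transitivity from [x] gives [xy] inside
    [xa]. *)
Lemma join_closed_join a b : join_closed J (join J a b).
Proof.
move=> x y Jx Jy z Jz.
have [xa|/nesym ax] := pselect (x = a).
  by rewrite xa in Jz; exact: Jtrans Jy _ Jz.
have abE : join J a x = join J a b by exact: join_line.
rewrite -abE in Jy *; apply: J_sym.
by apply: (Jtrans (J_sym Jy)).
Qed.

Lemma preprojective_join_transitive : preprojective J -> join_transitive J.
Proof.
move=> [_ veblen] a b x y z [p abp Jpxy] [q abq Jqyz].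
have [px|px] := pselect (p = x); first by exists x; [rewrite -px|exact: J_left].
have Jpyx : J p y x by exact: Jsymm.
(* The lines [px] and [qz] meet in [y], so [qp] and [xz] should meet in some [r], the natural
   witness on [ab]. *)
case: (veblen q p x z); first by apply: Or33; exists y.
- by move=> qp; exists p => //; rewrite qp in Jqyz; exact: Jtrans Jqyz _ Jpxy.
- by move=> ->; exists a; [exact: J_left|exact: J_right].
move=> [r [Jqrp Jxrz]].
have abr : join J a b r by exact: join_closed_join abq abp _ Jqrp.
have [zr|zr] := pselect (z = r); last first.
  by exists r => //; apply/J_sym/Jsymm => //; exact: J_sym.
(* If [z] is itself on [ab], closedness puts [y] and then [x] on [ab], and [x] serves as witness. *)
rewrite -zr in abr.
have aby : join J a b y by exact: join_closed_join abq abr _ Jqyz.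
by exists x; [exact: join_closed_join abp aby _ Jpxy|exact: J_left].
Qed.

Section JoinTransitive.
Hypothesis Jjoin : join_transitive J.

(** Only two points of [C] are involved, and their join stays inside [C]. *)
Lemma join_rel_trans C x y z :
  join_closed J C -> join_rel J C x y -> join_rel J C y z -> join_rel J C x z.
Proof.
move=> clC [p Cp Jpxy] [q Cq Jqyz].
case: (Jjoin (a := p) (b := q) (x := x) (y := y) (z := z)).
- by exists p => //; exact: J_left.
- by exists q => //; exact: J_right.
by move=> r pqr Jrxz; exists r => //; exact: clC pqr.
Qed.

Lemma join_closed_join_rel C x :
  join_closed J C -> join_closed J [set y | join_rel J C y x].
Proof.
move=> clC y z [c Cc Jcyx] [d Cd Jdzx] w Jywz.
have Cyx : join_rel J C y x by exists c.
have Czx : join_rel J C z x by exists d.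
have [cy|cy] := pselect (c = y).
  by apply: (join_rel_trans (y := z)) => //; exists y => //; rewrite -cy.
(* As [c <> y], symmetry reverses the relation between [y] and [x], so [z] is related to [y] through
   [x]. *)
have [e Ce Jezy] : join_rel J C z y.
  by apply: (join_rel_trans (y := x)) => //; exists c => //; exact: Jsymm.
have [yz|yz] := pselect (y = z).
  by rewrite -yz in Jywz; rewrite (J_diag Jywz).
apply: (join_rel_trans (y := y)) => //; exists e => //.
by apply: J_sym; apply: (Jtrans (J_sym Jezy)).
Qed.

Lemma join_closed_exchange_space : exchange_space (join_closed J).
Proof.
split; first exact: join_closed_closure_space.
move=> C clC x y NCx NCy xy.
(* Over the empty set no point is related to [x], not even [x]; there the closed set [{x}] bounds
   the closure instead. *)
have [C0|/eqP/set0P[c0 Cc0]] := pselect (C = set0).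
  suff -> : y = x by move=> D [_]; apply; right.
  by apply: (xy [set x]); split; [exact: join_closed1|rewrite C0 set0U].
have [c Cc Jcyx] : join_rel J C y x.
  apply: (xy [set z | join_rel J C z x]).
  split=> [|z [Cz|->]]; first exact: join_closed_join_rel.
    by exists z => //; exact: J_left.
  by exists c0 => //; exact: J_right.
have Jcxy : J c x y by apply: Jsymm => // cy; rewrite -cy in NCy.
move=> D [clD sCD]; apply: (clD c y) Jcxy.
  by apply: sCD; left.
by apply: sCD; right.
Qed.

End JoinTransitive.
End EquivalenceRelational.

Section Converse.
Hypothesis Jjoin : join_transitive J.

Lemma join_transitive_trans : join_space_transitive J.
Proof.
move=> a b c Jabc x Jaxb.
(* Since [aa] is [{a}], join-transitivity of [aa] is transitivity of [J a]. *)
have aa : join J a a a by exact: J_left.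
by case: (Jjoin (a := a) (b := a) (x := x) (y := b) (z := c));
  [exists a|exists a|move=> _ /J_diag ->].
Qed.

Lemma join_transitive_join_closed_join a b : join_closed J (join J a b).
Proof.
move=> x y abx aby z Jxzy.
(* The chain runs from [z] to [y] via [x], then from [y] to [a] via [b]. *)
have [p abp Jpza] : join_rel J (join J a b) z a.
  apply: (Jjoin (y := y)); first by exists x.
  by exists b; [exact: J_right|exact: J_sym].
by apply: (join_transitive_trans abp); exact: J_sym.
Qed.

(** Exchange over [{a}] turns [b] in the closure of [{a, c}] into [c] in the closure of [{a, b}],
    which lies in the closed set [ab]. *)
Lemma exchange_join_space_symmetric :
  exchange_space (join_closed J) -> join_space_symmetric J.
Proof.
move=> [_ exch] a b c Jabc ab.
have bc : entails (join_closed J) [set a] b c.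
  apply: exch; first exact: join_closed1.
  - by move=> /= ca; rewrite ca in Jabc; case: ab; rewrite (J_diag Jabc).
  - by move=> /= ba; case: ab.
  by move=> D [clD sacD]; apply: (clD a c) Jabc; apply: sacD; [left|right].
apply: (bc (join J a b)); split; first exact: join_transitive_join_closed_join.
by move=> z [] ->; [exact: J_left|exact: J_right].
Qed.

Lemma join_transitive_preprojective :
  join_space_symmetric J -> preprojective J.
Proof.
move=> Jsymm; split; first by split=> //; exact: join_transitive_trans.
move=> a b c d [->|->|[e [Jbec Jaed]]].
- by apply: Or33; exists c; split; [exact: J_right|exact: J_left].
- by apply: Or33; exists d; split; [exact: J_left|exact: J_right].
have [->|ab] := pselect (a = b); first exact: Or31.
have [->|cd] := pselect (c = d); first exact: Or32.
apply: Or33; have [eb|be] := pselect (b = e).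
  by exists d; split; [apply: Jsymm => //; rewrite eb|exact: J_right].
(* The common point [e] links [c] to [d]: [c] to [e] via [b], by symmetry, and [e] to [d] via
   [a]. *)
have [p abp Jpcd] : join_rel J (join J a b) c d.
  apply: (Jjoin (y := e)); first by exists b; [exact: J_right|exact: Jsymm].
  by exists a => //; exact: J_left.
by exists p; split=> //; apply: J_sym; apply: Jsymm; [exact: J_sym|exact: nesym].
Qed.

End Converse.
End JoinSpaceTheory.

Theorem corollary6p4 (X : Type) (J : X -> X -> X -> Prop) :
  join_space J ->
  (preprojective J <-> join_transitive J /\ matroid (join_closed J)).
Proof.
move=> joinJ; split=> [pJ|[Jjoin [exch _]]]; last first.
  apply: join_transitive_preprojective => //.
  exact: exchange_join_space_symmetric.
have [[Jtrans Jsymm] _] := pJ.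
have Jjoin : join_transitive J by exact: preprojective_join_transitive.
split=> //; split; first exact: join_closed_exchange_space.
exact: join_closed_combinatorial.
Qed.
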